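(* Let $P$ be the transition probability matrix of an irreducible random walk on $\mathbb{Z}$, with entries $P_{n,n+1}=a_n$, $P_{n,n}=b_n$, $P_{n,n-1}=c_n$, and let $\Psi$ be its $2\times 2$ spectral matrix. Let $P=\widetilde P_L\widetilde P_U$ be a stochastic LU factorization with coefficients $\tilde r_n,\tilde s_n,\tilde y_n,\tilde x_n$ ($n\in\mathbb{Z}$), and let $\widehat P=\widetilde P_U\widetilde P_L$ be the transition probability matrix of the corresponding Darboux random walk, with coefficients $\hat a_n,\hat b_n,\hat c_n$ (all as described in the context). Assume that $M_{-1}=\int_{-1}^{1}\frac{\Psi(x)}{x}\,dx$ is well defined (entry by entry). Then the polynomials $(\widehat Q_n^\alpha)_{n\in\mathbb{Z}}$, $\alpha=1,2$, associated with $\widehat P$ are orthogonal with respect to the spectral matrix $$\widehat\Psi(x)=\boldsymbol T_0(x)\,\Psi_T(x)\,\boldsymbol T_0^*(x),\qquad \boldsymbol T_0(x)=\begin{pmatrix}\dfrac{x-\tilde r_0\tilde x_{-1}}{\tilde s_0}&-\dfrac{\tilde r_0\tilde y_{-1}}{\tilde s_0}\\ \tilde x_{-1}&\tilde y_{-1}\end{pmatrix},$$ where $$\Psi_T(x)=\frac{\tilde s_0}{\tilde y_0}\frac{\Psi(x)}{x}+\left[\frac{\hat a_{-1}}{\hat c_0}\begin{pmatrix}1/\tilde x_{-1}&0\\0&1/\tilde y_{-1}\end{pmatrix}-\frac{\tilde s_0}{\tilde y_0}M_{-1}\right]\delta_0(x).$$ Moreover, for all $n,m\ge0$, $$\int_{-1}^{1}\widehat{\boldsymbol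 Q}_n(x)\,\widehat\Psi(x)\,\widehat{\boldsymbol Q}_m^*(x)\,dx=\begin{pmatrix}1/\hat\pi_n&0\\0&1/\hat\pi_{-n-1}\end{pmatrix}\delta_{n,m},\qquad \widehat{\boldsymbol Q}_n(x)=\begin{pmatrix}\widehat Q_n^1(x)&\widehat Q_n^2(x)\\ \widehat Q_{-n-1}^1(x)&\widehat Q_{-n-1}^2(x)\end{pmatrix},$$ where $(\hat\pi_n)_{n\in\mathbb{Z}}$ are the potential coefficients of $\widehat P$.
   Context: Random walk. $a_n+b_n+c_n=1$, $b_n\ge0$, $0<a_n,c_n<1$ for all $n\in\mathbb{Z}$. Polynomials and spectral matrix of $P$. For $\alpha=1,2$ the polynomials $(Q_n^\alpha)_{n\in\mathbb{Z}}$ are defined by $Q_0^1=1$, $Q_0^2=0$, $Q_{-1}^1=0$, $Q_{-1}^2=1$ and $xQ_n^\alpha(x)=a_nQ_{n+1}^\alpha(x)+b_nQ_n^\alpha(x)+c_nQ_{n-1}^\alpha(x)$ for $n\in\mathbb{Z}$. The potential coefficients of $P$ are $\pi_0=1$, $\pi_n=\frac{a_0\cdots a_{n-1}}{c_1\cdots c_n}$, $\pi_{-n}=\frac{c_0c_{-1}\cdots c_{-n+1}}{a_{-1}\cdots a_{-n}}$, $n\ge1$. $P$ defines a self-adjoint operator of norm $\le1$ on $\ell^2_\pi(\mathbb{Z})$, and there exist unique measures $\psi_{11},\psi_{22}$ (positive) and $\psi_{12}=\psi_{21}$ (signed) on $[-1,1]$ such that $\sum_{\alpha,\beta=1}^2\int_{-1}^1Q_i^\alpha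 Q_j^\beta\,d\psi_{\alpha\beta}=\delta_{i,j}/\pi_j$ for all $i,j\in\mathbb{Z}$. For simplicity these measures are assumed to have densities, $d\psi_{\alpha\beta}(x)=\psi_{\alpha\beta}(x)\,dx$, and the spectral matrix is $\Psi(x)=\begin{pmatrix}\psi_{11}(x)&\psi_{12}(x)\\ \psi_{12}(x)&\psi_{22}(x)\end{pmatrix}$. Here $\delta_0(x)$ is the Dirac mass at $0$ (so $\Psi_T(x)\,dx$ and $\widehat\Psi(x)\,dx$ are matrix-valued measures), $\delta_{n,m}$ is the Kronecker delta, and $A^*$ is the Hermitian transpose of $A$ (for real $x$). Stochastic LU factorization. $P=\widetilde P_L\widetilde P_U$ with $\widetilde P_L,\widetilde P_U$ stochastic, $(\widetilde P_L)_{n,n}=\tilde s_n$, $(\widetilde P_L)_{n,n-1}=\tilde r_n$, $(\widetilde P_U)_{n,n}=\tilde y_n$, $(\widetilde P_U)_{n,n+1}=\tilde x_n$, all other entries $0$; thus $\tilde r_n+\tilde s_n=1$, $\tilde y_n+\tilde x_n=1$, $a_n=\tilde s_n\tilde x_n$, $b_n=\tilde r_n\tilde x_{n-1}+\tilde s_n\tilde y_n$, $c_n=\tilde r_n\tilde y_{n-1}$ for $n\in\mathbb{Z}$, and $0<\tilde r_n,\tilde s_n,\tilde y_n,\tilde x_n<1$. Darboux transformation. $\widehat P=\widetilde P_U\widetilde P_L$ is tridiagonal and stochastic, with $\widehat P_{n,n+1}=\hat a_n=\tilde x_n\tilde s_{n+1}$, $\widehat P_{n,n}=\hat b_n=\tilde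 x_n\tilde r_{n+1}+\tilde y_n\tilde s_n$, $\widehat P_{n,n-1}=\hat c_n=\tilde y_n\tilde r_n$. Put $T_n^\alpha=\tilde y_nQ_n^\alpha+\tilde x_nQ_{n+1}^\alpha$ for $n\in\mathbb{Z}$, $\alpha=1,2$, and $\boldsymbol T_n=\begin{pmatrix}T_n^1&T_n^2\\ T_{-n-1}^1&T_{-n-1}^2\end{pmatrix}$ for $n\ge0$ (for $n=0$ this is the matrix $\boldsymbol T_0(x)$ displayed in the claim). The polynomials $\widehat Q_n^\alpha$, $n\in\mathbb{Z}$, $\alpha=1,2$, are defined by $\widehat{\boldsymbol Q}_n(x)=\boldsymbol T_n(x)\boldsymbol T_0^{-1}(x)$, $n\ge0$. (Equivalently, $\widehat Q_0^1=1$, $\widehat Q_0^2=0$, $\widehat Q_{-1}^1=0$, $\widehat Q_{-1}^2=1$ and $x\widehat Q_n^\alpha=\hat a_n\widehat Q_{n+1}^\alpha+\hat b_n\widehat Q_n^\alpha+\hat c_n\widehat Q_{n-1}^\alpha$, $n\in\mathbb{Z}$.) The potential coefficients of $\widehat P$ are $\hat\pi_0=1$, $\hat\pi_n=\frac{\hat a_0\cdots\hat a_{n-1}}{\hat c_1\cdots\hat c_n}$, $\hat\pi_{-n}=\frac{\hat c_0\cdots\hat c_{-n+1}}{\hat a_{-1}\cdots\hat a_{-n}}$, $n\ge1$. *)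

(* Defs.v *)
From HB Require Import structures.
From mathcomp Require Import all_boot all_order all_algebra.
From mathcomp Require Import all_classical all_reals all_analysis.

Set Implicit Arguments.
Unset Strict Implicit.
Unset Printing Implicit Defensive.

Import Order.TTheory GRing.Theory Num.Theory.
Import numFieldNormedType.Exports.

Local Open Scope classical_set_scope.
Local Open Scope ring_scope.

(* Matrices indexed by Z x Z are functions int -> int -> R. *)

Definition tridiag (R : realType) (lo di up : int -> R) : int -> int -> R :=
  fun i j => if j == i + 1 then up i
             else if j == i then di i
             else if j == i - 1 then lo i else 0.

(* The sum is finitely supported for banded matrices, the only ones used. *)
Definition zmulmx (R : realType) (A B : int -> int -> R) : int -> int -> R :=
  fun i j => \sum_(k \in [set: int]) A i k * B k j.

(* Irreducibility on Z follows from a n > 0 and c n > 0. *)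
Definition random_walk (R : realType) (a b c : int -> R) : Prop :=
  forall n : int,
    [/\ a n + b n + c n = 1, 0 <= b n, 0 < a n < 1 & 0 < c n < 1].

Definition lower_factor (R : realType) (r s : int -> R) : int -> int -> R :=
  tridiag r s (fun=> 0).

Definition upper_factor (R : realType) (y x : int -> R) : int -> int -> R :=
  tridiag (fun=> 0) y x.

Definition stochastic_LU (R : realType) (P : int -> int -> R)
    (r s y x : int -> R) : Prop :=
  (forall n : int,
     [/\ r n + s n = 1, y n + x n = 1, 0 < r n < 1 & 0 < s n < 1] /\
     (0 < y n < 1 /\ 0 < x n < 1)) /\
  (forall i j : int,
     P i j = zmulmx (lower_factor r s) (upper_factor y x) i j).

Definition darboux (R : realType) (r s y x : int -> R) : int -> int -> R :=
  zmulmx (upper_factor y x) (lower_factor r s).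

Definition dar_a (R : realType) (r s y x : int -> R) (n : int) : R :=
  darboux r s y x n (n + 1).

Definition dar_b (R : realType) (r s y x : int -> R) (n : int) : R :=
  darboux r s y x n n.

Definition dar_c (R : realType) (r s y x : int -> R) (n : int) : R :=
  darboux r s y x n (n - 1).

Definition potential (R : realType) (a c : int -> R) (n : int) : R :=
  match n with
  | Posz m => (\prod_(i < m) a i%:Z) / (\prod_(i < m) c i.+1%:Z)
  | Negz m => (\prod_(i < m.+1) c (- i%:Z)) / (\prod_(i < m.+1) a (- i.+1%:Z))
  end.

(* The superscript alpha = 1, 2 is the element 0, 1 of 'I_2. *)
Definition walk_polynomials (R : realType) (a b c : int -> R)
    (Q : 'I_2 -> int -> {poly R}) : Prop :=
  [/\ Q 0 0 = 1 /\ Q 1 0 = 0,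
      Q 0 (-1) = 0 /\ Q 1 (-1) = 1 &
      forall (al : 'I_2) (n : int),
        'X * Q al n = a n *: Q al (n + 1) + b n *: Q al n + c n *: Q al (n - 1)].

Definition darboux_T (R : realType) (y x : int -> R)
    (Q : 'I_2 -> int -> {poly R}) (al : 'I_2) (n : int) : {poly R} :=
  y n *: Q al n + x n *: Q al (n + 1).

(* The 2 x 2 matrix with rows Q_n^alpha and Q_{-n-1}^alpha, evaluated at t. *)
Definition poly_block (R : realType) (Q : 'I_2 -> int -> {poly R}) (n : nat)
    (t : R) : 'M[R]_2 :=
  \matrix_(i < 2, al < 2) (Q al (if i == 0 then n%:Z else - n%:Z - 1)).[t].

Definition mx2 (R : realType) (p q u v : R) : 'M[R]_2 :=
  \matrix_(i < 2, j < 2) if i == 0 then (if j == 0 then p else q)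
                         else (if j == 0 then u else v).

(* MxMeasure W A stands for the matrix-valued measure W(x) dx + A delta_0(x)
   on [-1, 1]. *)
Record mxmeasure (R : realType) := MxMeasure {
  density : R -> 'M[R]_2;
  atom0 : 'M[R]_2 }.

Definition mxm_finite (R : realType) (W : mxmeasure R) : Prop :=
  forall al be : 'I_2, (@lebesgue_measure R).-integrable `[-1, 1]
    (fun t : R => (density W t al be)%:E).

Definition mxm_mass (R : realType) (W : mxmeasure R) (E : set R) : 'M[R]_2 :=
  \matrix_(al < 2, be < 2)
    (\int[@lebesgue_measure R]_(t in E `&` `[-1, 1]) density W t al be
     + \1_E 0 * atom0 W al be).

(* The integral over [-1, 1] of the scalar function f against the (al, be)
   entry of W. *)
Definition mxm_int (R : realType) (W : mxmeasure R) (al be : 'I_2)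
    (f : R -> R) : R :=
  \int[@lebesgue_measure R]_(t in `[-1, 1]) (f t * density W t al be)
  + f 0 * atom0 W al be.

(* F(x) W(x) G(x)^* as a matrix-valued measure; f(x) delta_0(x) is
   f(0) delta_0(x). *)
Definition mxm_sandwich (R : realType) (F : R -> 'M[R]_2) (W : mxmeasure R)
    (G : R -> 'M[R]_2) : mxmeasure R :=
  MxMeasure (fun t => F t *m density W t *m (G t)^T)
            (F 0 *m atom0 W *m (G 0)^T).

(* W is the spectral matrix of the walk with polynomials Q: finite signed
   measures with equal off-diagonal entries, positive on the diagonal, for which
   the Q's are orthogonal. *)
Definition spectral_matrix (R : realType) (a c : int -> R)
    (Q : 'I_2 -> int -> {poly R}) (W : mxmeasure R) : Prop :=
  [/\ mxm_finite W,
      forall E : set R, measurable E ->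
        mxm_mass W E 0 1 = mxm_mass W E 1 0,
      forall (al : 'I_2) (E : set R), measurable E ->
        0 <= mxm_mass W E al al &
      forall i j : int,
        \sum_(al < 2) \sum_(be < 2)
           mxm_int W al be (fun t => (Q al i).[t] * (Q be j).[t])
        = (i == j)%:R / potential a c j].

Definition moment_m1 (R : realType) (Psi : R -> 'M[R]_2) : 'M[R]_2 :=
  \matrix_(al < 2, be < 2)
    \int[@lebesgue_measure R]_(t in `[-1, 1]) (Psi t al be / t).

Definition moment_m1_defined (R : realType) (Psi : R -> 'M[R]_2) : Prop :=
  forall al be : 'I_2, (@lebesgue_measure R).-integrable `[-1, 1]
    (fun t : R => (Psi t al be / t)%:E).

Definition T0_mx (R : realType) (r s y x : int -> R) (t : R) : 'M[R]_2 :=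
  mx2 ((t - r 0 * x (-1)) / s 0) (- (r 0 * y (-1) / s 0))
      (x (-1))                   (y (-1)).

Definition Psi_T (R : realType) (r s y x : int -> R) (Psi : R -> 'M[R]_2) :
    mxmeasure R :=
  MxMeasure
    (fun t => (s 0 / y 0) *: (t^-1 *: Psi t))
    ((dar_a r s y x (-1) / dar_c r s y x 0)
         *: mx2 (x (-1))^-1 0 0 (y (-1))^-1
     - (s 0 / y 0) *: moment_m1 Psi).

Definition Psi_hat (R : realType) (r s y x : int -> R) (Psi : R -> 'M[R]_2) :
    mxmeasure R :=
  mxm_sandwich (T0_mx r s y x) (Psi_T r s y x Psi) (T0_mx r s y x).

(* Main.v *)
(* With T_n = y_n Q_n + x_n Q_{n+1}, the factorization gives
   X Q_n = s_n T_n + r_n T_{n-1}, and Qhat_n T_0 = T_n, so orthogonality of the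
   Qhat_n for Psihat is orthogonality of the T_n for Psi_T.  Multiplication by X
   turns Psi_T into (s_0 / y_0) Psi and kills the atom; hence pairing X Q_n with
   T_m gives a first order recurrence in n for the pairings of T_n and T_m,
   which the claimed values satisfy too.  Both agree at n = m = -1 because
   T_{-1} is constant and the atom contains - (s_0 / y_0) M_{-1}.

   The diagonal entries of Psihat are positive since every vector polynomial is
   a combination of the Qhat_n, so that squares of polynomials have nonnegative
   integrals; on a compact interval this forces positivity of the measure. *)

Require Import Defs.
From HB Require Import structures.
From mathcomp Require Import all_boot all_order all_algebra.
From mathcomp Require Import all_classical all_reals all_analysis.
From mathcomp Require Import measurable_realfun zify ring lra.

Set Implicit Arguments.
Unset Strict Implicit.
Unset Printing Implicit Defensive.

Import Order.TTheory GRing.Theory Num.Theory.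
Import numFieldNormedType.Exports.

Local Open Scope classical_set_scope.
Local Open Scope ring_scope.

(** * Measures with nonnegative integrals of squares *)

(* As [n] grows, [(1 - u ^+ n) ^+ (2 ^ n)] tends to 1 for [u < 1/2] and to 0 for
   [1/2 < u <= 1]; here [u = 1/2 + ((t - x0)^2 - rho^2) / 8] stays in [0, 1] on
   [-1, 1], so these polynomials converge boundedly to the indicator of
   the ball of radius [rho] around [x0]. *)
Definition step_poly (R : realType) (x0 rho : R) (n : nat) : {poly R} :=
  (1 - ((2^-1 - rho ^+ 2 / 8)%:P + 8^-1 *: ('X - x0%:P) ^+ 2) ^+ n) ^+ (2 ^ n).

Lemma step_polyE (R : realType) (x0 rho t : R) (n : nat) :
  (step_poly x0 rho n).[t]
  = (1 - (2^-1 + ((t - x0) ^+ 2 - rho ^+ 2) / 8) ^+ n) ^+ (2 ^ n).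
Proof.
rewrite /step_poly -polyC1.
rewrite !(horner_exp, hornerD, hornerN, hornerZ, hornerX, hornerC).
by congr ((1 - _ ^+ n) ^+ _); lra.
Qed.

Lemma bernoulli_ineq (R : realDomainType) (h : R) (n : nat) :
  -1 <= h -> 1 + h *+ n <= (1 + h) ^+ n.
Proof.
move=> h1; elim: n => [|n IH]; first by rewrite mulr0n addr0 expr0.
rewrite exprS; apply: (@le_trans _ _ ((1 + h) * (1 + h *+ n))); last first.
  by apply: ler_wpM2l => //; rewrite -lerBlDl sub0r.
rewrite -subr_ge0 (_ : _ - _ = (h ^+ 2) *+ n); last first.
  by rewrite mulrS -[h *+ n]mulr_natr -[_ ^+ 2 *+ n]mulr_natr; ring.
by rewrite mulrn_wge0 // sqr_ge0.
Qed.

(** Bernoulli's inequality with [h = - u ^+ n] and exponent [2 ^ n] bounds the sequence below by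
    [1 - (2 * u) ^+ n], which tends to 1 because [2 * u < 1]. *)
Lemma cvg_step_lt (R : realType) (u : R) : 0 <= u < 2^-1 ->
  (1 - u ^+ n) ^+ (2 ^ n) @[n --> \oo] --> (1 : R).
Proof.
move=> /andP[u0 u2]; have u1 : u <= 1 by lra.
apply: (@squeeze_cvgr _ _ _ _ (fun n => 1 - (2 * u) ^+ n) (fun=> 1)).
- near=> n; apply/andP; split.
    have -> : 1 - (2 * u) ^+ n = 1 + (- u ^+ n) *+ (2 ^ n)%N.
      by rewrite exprMn mulNrn -[u ^+ n *+ _]mulr_natr natrX mulrC.
    by apply: bernoulli_ineq; rewrite lerN2 exprn_ile1.
  by rewrite exprn_ile1 // ?subr_ge0 ?gerBl ?exprn_ile1 ?exprn_ge0.
- rewrite -[X in _ --> X]subr0; apply: cvgB; first exact: cvg_cst.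
  by apply: cvg_expr; rewrite ger0_norm; lra.
- exact: cvg_cst.
Unshelve. all: by end_near. Qed.

(** With [v = u ^+ n] and [N = 2 ^ n], the product of [(1 - v) ^+ N] and [(1 + v) ^+ N] is at most
    1, while Bernoulli gives [(1 + v) ^+ N >= (2 * u) ^+ n]. This yields a geometric upper bound of
    ratio [(2 * u)^-1 < 1]. *)
Lemma cvg_step_gt (R : realType) (u : R) : 2^-1 < u <= 1 ->
  (1 - u ^+ n) ^+ (2 ^ n) @[n --> \oo] --> (0 : R).
Proof.
move=> /andP[u2 u1]; have u0 : 0 <= u by lra.
apply: (@squeeze_cvgr _ _ _ _ (fun=> 0) (fun n => ((2 * u)^-1) ^+ n)).
- near=> n; apply/andP; split.
    by rewrite exprn_ge0 // subr_ge0 exprn_ile1.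
  have un0 : 0 <= u ^+ n by rewrite exprn_ge0.
  have k0 : 0 < (2 * u) ^+ n by rewrite exprn_gt0 //; lra.
  rewrite exprVn -[leRHS]mul1r ler_pdivlMr //.
  apply: (@le_trans _ _ ((1 - u ^+ n) ^+ (2 ^ n) * (1 + u ^+ n) ^+ (2 ^ n))).
    apply: ler_wpM2l; first by rewrite exprn_ge0 // subr_ge0 exprn_ile1.
    apply: le_trans (bernoulli_ineq _ _); last by lra.
    by rewrite -[u ^+ n *+ _]mulr_natr natrX exprMn mulrC lerDr.
  rewrite -exprMn exprn_ile1 //; last by rewrite -subr_sqr expr1n gerBl sqr_ge0.
  by rewrite mulr_ge0 // ?subr_ge0 ?exprn_ile1 // addr_ge0.
- exact: cvg_cst.
- apply: cvg_expr; rewrite ger0_norm ?invr_ge0 ?invf_lt1; lra.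
Unshelve. all: by end_near. Qed.

(** Since [(t - x0) ^+ 2 <= 4] and [rho ^+ 2 <= 1], the divisor 8 keeps [u] between 3/8 and 1. *)
Lemma step_poly_bound (R : realType) (x0 rho t : R) (n : nat) :
  -1 <= x0 <= 1 -> -1 <= t <= 1 -> 0 <= rho <= 1 ->
  0 <= (step_poly x0 rho n).[t] <= 1.
Proof.
move=> hx ht hr; rewrite step_polyE; set u := 2^-1 + _.
have hd : (t - x0) ^+ 2 <= 4.
  have -> : 4 = 2 ^+ 2 :> R by ring.
  rewrite -(real_normK (num_real (t - x0))) lerXn2r ?nnegrE //.
  by rewrite ler_norml; lra.
have hd0 : 0 <= (t - x0) ^+ 2 by exact: sqr_ge0.
have hr1 : rho ^+ 2 <= 1 by rewrite exprn_ile1 //; lra.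
have hr0 : 0 <= rho ^+ 2 by exact: sqr_ge0.
have u0 : 0 <= u by rewrite /u; lra.
have u1 : u <= 1 by rewrite /u; lra.
by rewrite exprn_ge0 ?exprn_ile1 ?subr_ge0 ?gerBl ?exprn_ile1 ?exprn_ge0.
Qed.

Lemma cvg_step_poly_in (R : realType) (x0 rho t : R) :
  0 <= rho <= 1 -> `|t - x0| < rho ->
  (step_poly x0 rho n).[t] @[n --> \oo] --> (1 : R).
Proof.
move=> hr ht; under eq_fun do rewrite step_polyE; apply: cvg_step_lt.
have : (t - x0) ^+ 2 < rho ^+ 2.
  by rewrite -(real_normK (num_real (t - x0))) ltr_pXn2r // nnegrE; lra.
have : 0 <= (t - x0) ^+ 2 by exact: sqr_ge0.
have : rho ^+ 2 <= 1 by rewrite exprn_ile1 //; lra.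
lra.
Qed.

Lemma cvg_step_poly_out (R : realType) (x0 rho t : R) :
  -1 <= x0 <= 1 -> -1 <= t <= 1 -> 0 <= rho -> rho < `|t - x0| ->
  (step_poly x0 rho n).[t] @[n --> \oo] --> (0 : R).
Proof.
move=> hx ht hr h; under eq_fun do rewrite step_polyE; apply: cvg_step_gt.
have : rho ^+ 2 < (t - x0) ^+ 2.
  by rewrite -(real_normK (num_real (t - x0))) ltr_pXn2r // nnegrE.
have : 0 <= rho ^+ 2 by exact: sqr_ge0.
have : (t - x0) ^+ 2 <= 4.
  have -> : 4 = 2 ^+ 2 :> R by ring.
  rewrite -(real_normK (num_real (t - x0))) lerXn2r ?nnegrE //.
  by rewrite ler_norml; lra.
lra.
Qed.

Lemma integrable_horner (R : realType) (w : R -> R) (p : {poly R}) :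
  (@lebesgue_measure R).-integrable `[-1, 1] (fun t => (w t)%:E) ->
  (@lebesgue_measure R).-integrable `[-1, 1] (fun t => (p.[t] * w t)%:E).
Proof.
move=> iw.
have -> : (fun t => (p.[t] * w t)%:E)
    = ((EFin \o horner p) \* (fun t => (w t)%:E))%E by apply/funext => t.
apply: integrableMr => //.
  apply: measurable_funS (continuous_measurable_fun _) => //.
  exact: continuous_horner.
have [M hM] := poly_itv_bound p (-1) 1.
exists M; split; first exact: num_real.
move=> K MK t /=; rewrite in_itv /= => tD.
by apply: le_trans (hM _ tD) _; exact: ltW.
Qed.

(** Squares of [step_poly] tend to the indicator of the ball off its boundary, and dominated
    convergence with bound [|w|] passes to the limit. The condition [|x0| != rho] keeps 0 off the
    boundary, so that the atom term converges too. *)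
Lemma ball_mass_ge0 (R : realType) (w : R -> R) (A x0 rho : R) :
  (@lebesgue_measure R).-integrable `[-1, 1] (fun t => (w t)%:E) ->
  (forall p : {poly R}, 0 <=
     \int[@lebesgue_measure R]_(t in `[-1, 1]) (p.[t] ^+ 2 * w t)
     + p.[0] ^+ 2 * A) ->
  -1 <= x0 <= 1 -> 0 <= rho <= 1 -> `|x0| != rho ->
  0 <= \int[@lebesgue_measure R]_(t in ball x0 rho `&` `[-1, 1]) w t
       + \1_(ball x0 rho) 0 * A.
Proof.
move=> iw hp hx hr hrx.
have hD : measurable (`[-1, 1]%classic : set R) by [].
pose B : set R := ball x0 rho.
have mB : measurable B by exact: measurable_ball.
pose q n := step_poly x0 rho n.
pose f_ n t := ((q n).[t] ^+ 2 * w t)%:E.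
pose f (t : R) := (\1_B t * w t)%:E.
have if_ n : (@lebesgue_measure R).-integrable `[-1, 1] (f_ n).
  have -> : f_ n = fun t => ((q n ^+ 2).[t] * w t)%:E.
    by apply/funext => t; rewrite horner_exp.
  exact: integrable_horner.
have mf : measurable_fun (`[-1, 1]%classic : set R) f.
  apply/measurable_EFinP; apply: measurable_funM; first exact: measurable_indic.
  by apply/measurable_EFinP; exact: measurable_int iw.
have cv t : -1 <= t <= 1 -> `|t - x0| != rho ->
    (q n).[t] ^+ 2 @[n --> \oo] --> (\1_B t : R).
  move=> ht tr; have [tB|tB] := ltP `|t - x0| rho.
    have -> : \1_B t = 1 * 1 :> R.
      by rewrite mulr1 indicE mem_set // /B /ball /= distrC.
    by apply: cvgM; exact: cvg_step_poly_in.
  have {}tB : rho < `|t - x0| by rewrite lt_neqAle eq_sym tr.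
  have -> : \1_B t = 0 * 0 :> R.
    rewrite mulr0 indicE memNset // /B /ball /= distrC; apply/negP.
    by rewrite -leNgt ltW.
  apply: cvgM; apply: cvg_step_poly_out => //; lra.
have [|||ilim _ fcv] := @dominated_convergence _ _ _ (@lebesgue_measure R) _ hD
    f_ f (fun t => `|(w t)%:E|%E) (fun n => measurable_int _ (if_ n)) mf.
  (* The exceptional null set is the boundary of the ball, where the limit need not be the
     indicator. *)
  - exists [set x0 + rho; x0 - rho]; split.
    + exact: measurableU.
    + by rewrite measureU0 //; apply: lebesgue_measure_set1.
    + move=> t /= /not_implyP[]; rewrite in_itv /= => tD ncv.
      apply: contrapT => tr; apply: ncv.
      have tr' : `|t - x0| != rho.
        apply/eqP => h; apply: tr; rewrite -h.
        by have [_|_] := ger0P (t - x0); [left|right]; ring.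
      rewrite /f_ /f; apply: cvg_EFin; first by near=> n.
      apply: cvgM; [exact: cv|exact: cvg_cst].
  - exact: integrable_abse.
  - apply: aeW => t n /=; rewrite in_itv /= => tD.
    rewrite lee_fin normrM ler_piMl // ger0_norm ?sqr_ge0 // exprn_ile1 //.
      by have /andP[] := step_poly_bound n hx tD hr.
    by have /andP[] := step_poly_bound n hx tD hr.
have {}fcv : \int[@lebesgue_measure R]_(t in `[-1, 1]) ((q n).[t] ^+ 2 * w t)
    @[n --> \oo] --> \int[@lebesgue_measure R]_(t in `[-1, 1]) (\1_B t * w t).
  move: fcv; rewrite -[X in _ --> X -> _]fineK; first by move/fine_cvg.
  exact: integrable_fin_num.
have c0 : (q n).[0] ^+ 2 @[n --> \oo] --> (\1_B 0 : R).
  by apply: cv; [lra | rewrite sub0r normrN].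
rewrite Rintegral_mkcondl -/B (_ : \int[_]_(t in _) _ =
    \int[@lebesgue_measure R]_(t in `[-1, 1]) (\1_B t * w t)); last first.
  by apply: eq_Rintegral => t _; rewrite patch_indic /= mulrC.
apply: (cvgr_to_ge (cvgD fcv (cvgM c0 (cvg_cst A)))).
by near=> n; exact: hp.
Unshelve. all: by end_near. Qed.

(** Balls around 0 of radius [1 / (n + 1)] have nonnegative mass; as they shrink, the density
    contributes less and less and only the atom remains. *)
Lemma square_positive_atom_ge0 (R : realType) (w : R -> R) (A : R) :
  (@lebesgue_measure R).-integrable `[-1, 1] (fun t => (w t)%:E) ->
  (forall p : {poly R}, 0 <=
     \int[@lebesgue_measure R]_(t in `[-1, 1]) (p.[t] ^+ 2 * w t)
     + p.[0] ^+ 2 * A) ->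
  0 <= A.
Proof.
move=> iw hp.
have hD : measurable (`[-1, 1]%classic : set R) by [].
pose B n : set R := ball (0 : R) n.+1%:R^-1.
have mB n : measurable (B n) by exact: measurable_ball.
pose f_ n (t : R) := (\1_(B n) t * w t)%:E.
have mf_ n : measurable_fun (`[-1, 1]%classic : set R) (f_ n).
  apply/measurable_EFinP; apply: measurable_funM; first exact: measurable_indic.
  by apply/measurable_EFinP; exact: measurable_int iw.
have cv (t : R) : t != 0 -> \1_(B n) t @[n --> \oo] --> (0 : R).
  move=> t0; apply: cvg_near_cst.
  have t0' : 0 < `|t| by rewrite normr_gt0.
  near=> n; rewrite indicE memNset // /B /ball /= sub0r normrN; apply/negP.
  rewrite -leNgt; near: n; apply: filterS (near_infty_natSinv_lt (PosNum t0')).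
  by move=> n /ltW.
have [||||ilim _ fcv] := @dominated_convergence _ _ _ (@lebesgue_measure R) _ hD
    f_ (cst 0%E) (fun t => `|(w t)%:E|%E) mf_.
- exact: measurable_cst.
- exists [set 0]; split => //; first exact: lebesgue_measure_set1.
  move=> t /= /not_implyP[]; rewrite in_itv /= => tD ncv.
  apply: contrapT => /eqP t0; apply: ncv.
  apply: cvg_EFin; first by near=> n.
  rewrite -[X in _ --> X](mul0r (w t)).
  apply: cvgM; [exact: cv|exact: cvg_cst].
- exact: integrable_abse.
- apply: aeW => t n /= tD.
  rewrite lee_fin normrM ler_piMl // indicE.
  by case: (_ \in _); rewrite ?normr1 ?normr0.
have {}fcv : \int[@lebesgue_measure R]_(t in `[-1, 1]) (\1_(B n) t * w t)
    @[n --> \oo] --> (0 : R).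
  by move: fcv; rewrite integral_cst // mul0e => /fine_cvg.
rewrite -[A]add0r; apply: (cvgr_to_ge (cvgD fcv (cvg_cst A))).
near=> n.
have := @ball_mass_ge0 R w A 0 n.+1%:R^-1 iw hp.
rewrite normr0 eq_sym invr_eq0 pnatr_eq0 /= invr_ge0 ler0n.
rewrite invf_le1 ?ltr0n // ler1n.
rewrite indicE mem_set ?mul1r; last exact: ballxx.
rewrite Rintegral_mkcondl (_ : \int[_]_(t in _) _ =
    \int[@lebesgue_measure R]_(t in `[-1, 1]) (\1_(B n) t * w t)); last first.
  by apply: eq_Rintegral => t _; rewrite patch_indic /= mulrC.
by apply => //; lra.
Unshelve. all: by end_near. Qed.

(** By Lebesgue differentiation, [w t] is for almost every [t] a limit of averages over small balls
    around [t]. For [t != 0] these balls eventually avoid 0, so the atom drops out of the mass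
    bound. *)
Lemma square_positive_density_ge0 (R : realType) (w : R -> R) (A : R) :
  (@lebesgue_measure R).-integrable `[-1, 1] (fun t => (w t)%:E) ->
  (forall p : {poly R}, 0 <=
     \int[@lebesgue_measure R]_(t in `[-1, 1]) (p.[t] ^+ 2 * w t)
     + p.[0] ^+ 2 * A) ->
  {ae @lebesgue_measure R, forall t, -1 <= t <= 1 -> 0 <= w t}.
Proof.
move=> iw hp.
have hD : measurable (`[-1, 1]%classic : set R) by [].
(* Extended by zero outside the interval, [w] is locally integrable on the line, as the
   differentiation theorem requires. *)
have locw := integrable_locally hD iw.
pose D : set R := `[-1, 1]%classic.
pose rho n : R := n.+1%:R^-1.
have rho0 n : 0 < rho n by rewrite invr_gt0 ltr0n.
pose B (x : R) n : set R := ball x (rho n).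
have hB x : nicely_shrinking x (B x).
  split; first by move=> n; exact: measurable_ball.
  exists (1, fun n => PosNum (rho0 n)); split => //=.
  - exact: cvg_harmonic.
  - by move=> n t.
  - by move=> n; rewrite mul1e.
have [N [mN N0 sN]] := lebesgue_differentiation locw.
(* The point 0 joins the null set because every ball around it carries the atom. *)
exists (N `|` [set 0]); split.
- by apply: measurableU.
- by rewrite measureU0 //; apply: lebesgue_measure_set1.
move=> t /= /not_implyP[tD wt].
have [->|/eqP t0] := pselect (t = 0); first by right.
left; apply: sN => /= lt; apply: wt.
have /fine_cvgP[_ cv] := nice_lebesgue_differentiation hB locw lt.
have <- : (w \_ `[-1, 1]) t = w t by rewrite patchE mem_set //= in_itv.
apply: (cvgr_to_ge cv).
have t0' : 0 < `|t| by rewrite normr_gt0.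
have hn := near_infty_natSinv_lt (PosNum t0').
near=> n.
rewrite /= fine_ge0 // mule_ge0 ?inve_ge0 //.
rewrite (_ : (\int[_]_(y in _) _)%E =
  (\int[@lebesgue_measure R]_(y in B t n `&` D) (w y)%:E)%E); last first.
  rewrite integral_mkcondr; apply: eq_integral => y _.
  by rewrite !patchE; case: ifP.
have nt : rho n < `|t| by near: n; exact: hn.
have := @ball_mass_ge0 R w A t (rho n) iw hp tD.
rewrite (ltW (rho0 n)) invf_le1 ?ltr0n // ler1n /=.
rewrite (gt_eqF nt) indicE memNset; last first.
  by rewrite /ball /= subr0; apply/negP; rewrite -leNgt ltW.
rewrite mul0r addr0 -/(B t n) => /(_ isT isT).
rewrite -lee_fin /Rintegral fineK //; apply: integrable_fin_num.
  by apply: measurableI => //; exact: measurable_ball.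
apply: integrableS iw => //; apply: measurableI => //.
exact: measurable_ball.
Unshelve. all: by end_near. Qed.

(** Atom and density are nonnegative separately; since [w = |w|] almost everywhere on the interval,
    its integral is that of a function nonnegative everywhere. *)
Lemma square_positive_mass_ge0 (R : realType) (w : R -> R) (A : R) :
  (@lebesgue_measure R).-integrable `[-1, 1] (fun t => (w t)%:E) ->
  (forall p : {poly R}, 0 <=
     \int[@lebesgue_measure R]_(t in `[-1, 1]) (p.[t] ^+ 2 * w t)
     + p.[0] ^+ 2 * A) ->
  forall E : set R, measurable E ->
  0 <= \int[@lebesgue_measure R]_(t in E `&` `[-1, 1]) w t + \1_E 0 * A.
Proof.
move=> iw hp E mE; apply: addr_ge0; last first.
  by apply: mulr_ge0; [rewrite indicE|exact: square_positive_atom_ge0 iw hp].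
have mED : measurable (E `&` `[-1, 1]) by exact: measurableI.
have iwE : (@lebesgue_measure R).-integrable (E `&` `[-1, 1])
    (fun t => (w t)%:E).
  by apply: integrableS iw => //; exact: subIsetr.
rewrite /Rintegral fine_ge0 //.
rewrite (@ae_eq_integral _ _ _ (@lebesgue_measure R) (E `&` `[-1, 1])
  (fun t => (`|w t|)%:E) (fun t => (w t)%:E)) //.
- exact: integral_ge0.
- exact: measurable_int iwE.
- by have := measurable_int _ (integrable_abse iwE).
- have [N [mN N0 sN]] := square_positive_density_ge0 iw hp.
  exists N; split => // t /= wt; apply: sN => /= h; apply: wt => -[_].
  by rewrite /= in_itv /= => tD; rewrite ger0_norm // h.
Qed.

(** * Pairing vector polynomials against a matrix-valued measure *)

Lemma ord2P (i : 'I_2) : i = 0 \/ i = 1.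
Proof. by case: i => -[|[|]] // ?; [left|right]; apply/val_inj. Qed.

Section Sums.
Context (R : realType) (D : set R) (mD : measurable D).
Context (I : Type) (r : seq I) (h : I -> R -> R).
Hypothesis ih : forall i,
  (@lebesgue_measure R).-integrable D (fun t => (h i t)%:E).

Lemma integrable_EFin_sum :
  (@lebesgue_measure R).-integrable D (fun t => (\sum_(i <- r) h i t)%:E).
Proof.
rewrite (_ : (fun t => _) = (fun t => \sum_(i <- r) (h i t)%:E)%E); last first.
  by apply/funext => t; rewrite sumEFin.
by apply: integrable_sum.
Qed.

End Sums.

Lemma Rintegral_sum (R : realType) (D : set R) (mD : measurable D)
    (I : Type) (r : seq I) (h : I -> R -> R) :
  (forall i, (@lebesgue_measure R).-integrable D (fun t => (h i t)%:E)) ->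
  \int[@lebesgue_measure R]_(t in D) (\sum_(i <- r) h i t) =
  \sum_(i <- r) \int[@lebesgue_measure R]_(t in D) h i t.
Proof.
move=> ih; elim: r => [|i r IH].
  rewrite big_nil (eq_Rintegral _ (g := fun=> 0)) => [|t _].
    by rewrite Rintegral_cst // mul0r.
  by rewrite big_nil.
rewrite big_cons -IH -RintegralD //; [|exact: ih|exact: integrable_EFin_sum].
by apply: eq_Rintegral => t _; rewrite big_cons.
Qed.

Definition poly_int (R : realType) (W : mxmeasure R) (al be : 'I_2)
  (p : {poly R}) : R := mxm_int W al be (horner p).

Lemma poly_intE (R : realType) (W : mxmeasure R) (al be : 'I_2) (p q : {poly R}) :
  mxm_int W al be (fun t => p.[t] * q.[t]) = poly_int W al be (p * q).
Proof. by congr mxm_int; apply/funext => t; rewrite hornerM. Qed.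

Section Linear.
Context (R : realType) (W : mxmeasure R) (hW : mxm_finite W).

Lemma poly_intD al be (p q : {poly R}) :
  poly_int W al be (p + q) = poly_int W al be p + poly_int W al be q.
Proof.
rewrite /poly_int /mxm_int hornerD mulrDl addrACA; congr (_ + _).
rewrite -RintegralD //; try exact: integrable_horner.
by apply: eq_Rintegral => t _; rewrite hornerD mulrDl.
Qed.

Lemma poly_intZ al be (k : R) (p : {poly R}) :
  poly_int W al be (k *: p) = k * poly_int W al be p.
Proof.
rewrite /poly_int /mxm_int hornerZ mulrDr mulrA; congr (_ + _).
rewrite -RintegralZl //; try exact: integrable_horner.
by apply: eq_Rintegral => t _; rewrite hornerZ mulrA.
Qed.

Lemma poly_int0 al be : poly_int W al be 0 = 0.
Proof. by rewrite -[X in poly_int _ _ _ X](scale0r 0) poly_intZ mul0r. Qed.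

Lemma poly_int_sum al be (I : Type) (r : seq I) (p : I -> {poly R}) :
  poly_int W al be (\sum_(i <- r) p i) = \sum_(i <- r) poly_int W al be (p i).
Proof.
elim: r => [|i r IH]; first by rewrite !big_nil poly_int0.
by rewrite !big_cons poly_intD IH.
Qed.

End Linear.

(** With [f] and [g] read as row vectors of polynomials, this is the integral of [f W g^T], the
    pairing in which orthogonality is expressed. *)
Definition mxm_form (R : realType) (W : mxmeasure R)
    (f g : 'I_2 -> {poly R}) : R :=
  \sum_(al < 2) \sum_(be < 2) poly_int W al be (f al * g be).

Section Form.
Context (R : realType) (W : mxmeasure R) (hW : mxm_finite W).
Implicit Types f g h : 'I_2 -> {poly R}.

Lemma mxm_formDl f g h :
  mxm_form W (fun al => f al + g al) h = mxm_form W f h + mxm_form W g h.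
Proof.
rewrite /mxm_form -big_split; apply: eq_bigr => al _ /=.
by rewrite -big_split; apply: eq_bigr => be _ /=; rewrite mulrDl poly_intD.
Qed.

Lemma mxm_formDr f g h :
  mxm_form W h (fun al => f al + g al) = mxm_form W h f + mxm_form W h g.
Proof.
rewrite /mxm_form -big_split; apply: eq_bigr => al _ /=.
by rewrite -big_split; apply: eq_bigr => be _ /=; rewrite mulrDr poly_intD.
Qed.

Lemma mxm_formZl k f h :
  mxm_form W (fun al => k *: f al) h = k * mxm_form W f h.
Proof.
rewrite /mxm_form big_distrr; apply: eq_bigr => al _ /=.
by rewrite big_distrr; apply: eq_bigr => be _ /=; rewrite -scalerAl poly_intZ.
Qed.

Lemma mxm_formZr k f h :
  mxm_form W h (fun al => k *: f al) = k * mxm_form W h f.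
Proof.
rewrite /mxm_form big_distrr; apply: eq_bigr => al _ /=.
by rewrite big_distrr; apply: eq_bigr => be _ /=; rewrite -scalerAr poly_intZ.
Qed.

End Form.

Lemma sandwich_entry (R : realType) (F A G : 'M[R]_2) i j :
  (F *m A *m G^T) i j = \sum_(al < 2) \sum_(be < 2) (F i al * G j be) * A al be.
Proof.
rewrite mxE exchange_big; apply: eq_bigr => be _ /=.
rewrite !mxE mulr_suml; apply: eq_bigr => al _; ring.
Qed.

Section Sandwich.
Context (R : realType) (W : mxmeasure R) (hW : mxm_finite W).
Variables (F G : R -> 'M[R]_2) (p q : 'I_2 -> 'I_2 -> {poly R}).
Hypothesis Fp : forall t i al, F t i al = (p i al).[t].
Hypothesis Gq : forall t i al, G t i al = (q i al).[t].

Lemma density_sandwich t i j : density (mxm_sandwich F W G) t i j =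
  \sum_(al < 2) \sum_(be < 2) (p i al * q j be).[t] * density W t al be.
Proof.
rewrite /= sandwich_entry; apply: eq_bigr => al _; apply: eq_bigr => be _.
by rewrite Fp Gq hornerM.
Qed.

Lemma mxm_finite_sandwich : mxm_finite (mxm_sandwich F W G).
Proof.
move=> i j.
have -> : (fun t => (density (mxm_sandwich F W G) t i j)%:E) =
    (fun t => (\sum_(al < 2) \sum_(be < 2)
      (p i al * q j be).[t] * density W t al be)%:E).
  by apply/funext => t; rewrite density_sandwich.
have hD : measurable (`[-1, 1]%classic : set R) by [].
apply: (integrable_EFin_sum hD) => al; apply: (integrable_EFin_sum hD) => be.
exact: integrable_horner.
Qed.

Lemma poly_int_sandwich i j (u : {poly R}) :
  poly_int (mxm_sandwich F W G) i j u =
  \sum_(al < 2) \sum_(be < 2) poly_int W al be (u * (p i al * q j be)).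
Proof.
rewrite /poly_int /mxm_int /= sandwich_entry.
under [in RHS]eq_bigr do rewrite big_split.
rewrite big_split; congr (_ + _) => /=; last first.
  rewrite big_distrr; apply: eq_bigr => al _; rewrite big_distrr.
  by apply: eq_bigr => be _ /=; rewrite Fp Gq !hornerM mulrA.
have ih al be : (@lebesgue_measure R).-integrable `[-1, 1]
    (fun t => ((u * (p i al * q j be)).[t] * density W t al be)%:E).
  exact: integrable_horner.
have hD : measurable (`[-1, 1]%classic : set R) by [].
under [RHS]eq_bigr do rewrite -(Rintegral_sum hD _ (ih _)).
rewrite -(Rintegral_sum hD); last by move=> al; apply: (integrable_EFin_sum hD).
apply: eq_Rintegral => t _.
rewrite -/(density (mxm_sandwich F W G) t) density_sandwich.
rewrite big_distrr; apply: eq_bigr => al _; rewrite big_distrr.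
by apply: eq_bigr => be _ /=; rewrite !hornerM !mulrA.
Qed.

(** Since [f (F W G^T) g^T = (f F) W (g G)^T], the outer factors move onto the arguments. This
    reduces orthogonality for [Psi_hat] to orthogonality for [Psi_T]. *)
Lemma mxm_form_sandwich (f g : 'I_2 -> {poly R}) :
  mxm_form (mxm_sandwich F W G) f g =
  mxm_form W (fun al => \sum_(i < 2) f i * p i al)
             (fun be => \sum_(j < 2) g j * q j be).
Proof.
rewrite /mxm_form.
under eq_bigr do under eq_bigr do rewrite poly_int_sandwich.
have -> : \sum_(al < 2) \sum_(be < 2) poly_int W al be
      ((\sum_(i < 2) f i * p i al) * (\sum_(j < 2) g j * q j be)) =
    \sum_(al < 2) \sum_(be < 2) \sum_(i < 2) \sum_(j < 2)
      poly_int W al be (f i * g j * (p i al * q j be)).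
  apply: eq_bigr => al _; apply: eq_bigr => be _.
  rewrite mulr_suml poly_int_sum //; apply: eq_bigr => i _.
  rewrite mulr_sumr poly_int_sum //; apply: eq_bigr => j _.
  by rewrite mulrACA.
by rewrite !big_ord_recl !big_ord0 /=; ring.
Qed.

End Sandwich.

Lemma mxm_mass_itv (R : realType) (W : mxmeasure R) al be :
  mxm_mass W `[-1, 1] al be = poly_int W al be 1.
Proof.
rewrite /mxm_mass mxE setIid /poly_int /mxm_int hornerC; congr (_ + _ * _).
  by apply: eq_Rintegral => t _; rewrite hornerC mul1r.
by rewrite indicE mem_set //= in_itv /= lerN10 ler01.
Qed.

(** * Symmetry of matrix-valued measures *)

(** Symmetry is taken pointwise, for the atom and almost everywhere for the density, because in this
    form it passes to [F W F^T] point by point. *)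
Definition mxm_symmetric (R : realType) (W : mxmeasure R) : Prop :=
  (forall al be, atom0 W al be = atom0 W be al) /\
  {ae @lebesgue_measure R, forall t, -1 <= t <= 1 ->
    forall al be, density W t al be = density W t be al}.

(** Without an atom, the masses are the integrals of the density, and two integrable functions with
    equal integrals over all measurable subsets agree almost everywhere. *)
Lemma mass_sym_density (R : realType) (W : mxmeasure R) :
  mxm_finite W -> atom0 W = 0 ->
  (forall E : set R, measurable E -> mxm_mass W E 0 1 = mxm_mass W E 1 0) ->
  mxm_symmetric W.
Proof.
move=> hW W0 hE; split; first by move=> al be; rewrite W0 !mxE.
have hD : measurable (`[-1, 1]%classic : set R) by [].
have hI (E : set R) : E `<=` `[-1, 1] -> measurable E ->
    (\int[@lebesgue_measure R]_(t in E) (density W t 0 1)%:E =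
     \int[@lebesgue_measure R]_(t in E) (density W t 1 0)%:E)%E.
  move=> sE mE; have := hE E mE.
  rewrite /mxm_mass !mxE W0 !mxE !mulr0 !addr0 setIidl // /Rintegral => e.
  rewrite -[LHS]fineK ?e ?fineK //; apply: integrable_fin_num => //;
    exact: integrableS (hW _ _).
have [N [mN N0 sN]] := @integral_ae_eq _ _ _ (@lebesgue_measure R) _ hD _ _ (hW 0 1)
  (measurable_int _ (hW 1 0)) hI.
exists N; split => // t /= ht; apply: sN => /= h; apply: ht => tD al be.
have {}h : density W t 0 1 = density W t 1 0.
  by apply: EFin_inj; apply: h; rewrite /= in_itv.
by have [->|->] := ord2P al; have [->|->] := ord2P be.
Qed.

Lemma mxm_symmetric_mass (R : realType) (W : mxmeasure R) (E : set R) al be :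
  mxm_finite W -> mxm_symmetric W -> measurable E ->
  mxm_mass W E al be = mxm_mass W E be al.
Proof.
move=> hW [sA [N [mN N0 sN]]] mE.
rewrite /mxm_mass !mxE sA; congr (_ + _); rewrite /Rintegral; congr fine.
have mED : measurable (E `&` `[-1, 1]) by exact: measurableI.
apply: ae_eq_integral => //.
- by apply: measurable_int; apply: integrableS (hW al be).
- by apply: measurable_int; apply: integrableS (hW be al).
- exists N; split => // t /= ht; apply: sN => /= h; apply: ht => -[_].
  by rewrite /= in_itv /= => tD; rewrite h.
Qed.

Lemma mxm_symmetric_sandwich (R : realType) (W : mxmeasure R) (F : R -> 'M[R]_2) :
  mxm_symmetric W -> mxm_symmetric (mxm_sandwich F W F).
Proof.
move=> [sA [N [mN N0 sN]]].
have e (A B : 'M[R]_2) : (forall al be, A al be = A be al) ->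
    forall al be, (B *m A *m B^T) al be = (B *m A *m B^T) be al.
  move=> hA al be; rewrite !sandwich_entry exchange_big.
  by do 2 apply: eq_bigr => ? _; rewrite hA [X in X * _]mulrC.
split; first exact: e.
exists N; split => // t /= ht; apply: sN => /= h; apply: ht => tD al be.
by apply: e => *; exact: h.
Qed.

(** * Coefficients of the factorization and potentials *)

(** The sum over all integers may be computed on any duplicate-free list that contains the support
    of row [i] of [A]. *)
Lemma zmulmx_seq (R : realType) (A B : int -> int -> R) (i j : int) (s : seq int) :
  uniq s -> (forall k, k \notin s -> A i k = 0) ->
  zmulmx A B i j = \sum_(k <- s) A i k * B k j.
Proof.
move=> us hs; rewrite /zmulmx (fsbigE s) //.
  by apply: eq_bigl => k; rewrite in_setT.
by move=> k _ /hs ->; rewrite mul0r.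
Qed.

Ltac tridiag_entries :=
  rewrite /lower_factor /upper_factor /tridiag;
  repeat (case: eqP => ?; try (exfalso; lia)); rewrite ?mulr0 ?mul0r ?addr0 ?add0r.

Lemma zmulmx_lower (R : realType) (r s : int -> R) (B : int -> int -> R) (i j : int) :
  zmulmx (lower_factor r s) B i j = r i * B (i - 1) j + s i * B i j.
Proof.
rewrite (@zmulmx_seq _ _ _ _ _ [:: i - 1; i]).
- rewrite !big_cons big_nil addr0; congr (_ * _ + _ * _); tridiag_entries; done.
- by rewrite /= inE andbT; apply/eqP; lia.
- move=> k; rewrite !inE /lower_factor /tridiag negb_or.
  move=> /andP[/negbTE -> /negbTE ->].
  by case: ifP.
Qed.

Lemma zmulmx_upper (R : realType) (y x : int -> R) (B : int -> int -> R) (i j : int) :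
  zmulmx (upper_factor y x) B i j = y i * B i j + x i * B (i + 1) j.
Proof.
rewrite (@zmulmx_seq _ _ _ _ _ [:: i; i + 1]).
- rewrite !big_cons big_nil addr0; congr (_ * _ + _ * _); tridiag_entries; done.
- by rewrite /= inE andbT; apply/eqP; lia.
- move=> k; rewrite !inE /upper_factor /tridiag negb_or.
  move=> /andP[/negbTE -> /negbTE ->].
  by case: ifP.
Qed.

Section Factors.
Context (R : realType) (r s y x : int -> R).

Lemma dar_aE n : dar_a r s y x n = x n * s (n + 1).
Proof. by rewrite /dar_a /darboux zmulmx_upper; tridiag_entries. Qed.

Lemma dar_bE n : dar_b r s y x n = y n * s n + x n * r (n + 1).
Proof. by rewrite /dar_b /darboux zmulmx_upper; tridiag_entries. Qed.

Lemma dar_cE n : dar_c r s y x n = y n * r n.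
Proof. by rewrite /dar_c /darboux zmulmx_upper; tridiag_entries. Qed.

Context (a b c : int -> R) (hLU : stochastic_LU (tridiag c b a) r s y x).

Lemma LU_a n : a n = s n * x n.
Proof.
by have := hLU.2 n (n + 1); rewrite zmulmx_lower; tridiag_entries.
Qed.

Lemma LU_b n : b n = r n * x (n - 1) + s n * y n.
Proof.
by have := hLU.2 n n; rewrite zmulmx_lower; tridiag_entries => ->.
Qed.

Lemma LU_c n : c n = r n * y (n - 1).
Proof.
by have := hLU.2 n (n - 1); rewrite zmulmx_lower; tridiag_entries => ->.
Qed.

Lemma LU_neq0 n : [/\ r n != 0, s n != 0, y n != 0 & x n != 0].
Proof.
have [[_ _ /andP[r0 _] /andP[s0 _]] [/andP[y0 _] /andP[x0 _]]] := hLU.1 n.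
by rewrite !gt_eqF.
Qed.

End Factors.

Lemma potential0 (R : realType) (a c : int -> R) : potential a c 0 = 1.
Proof. by rewrite -[0]/(Posz 0) /potential !big_ord0 divr1. Qed.

(** This is detailed balance, in one formula for both signs of the index. *)
Lemma potentialS (R : realType) (a c : int -> R) (n : int) :
  (forall k, a k != 0) -> (forall k, c k != 0) ->
  potential a c (n + 1) * c (n + 1) = potential a c n * a n.
Proof.
move=> a0 c0; case: n => m.
  rewrite [_ + 1](_ : _ = Posz m.+1); last by lia.
  rewrite /potential !big_ord_recr /=.
  have h : \prod_(i < m) c i.+1 != 0 by apply/prodf_neq0 => *; apply: c0.
  by field; rewrite h c0.
case: m => [|m].
  (* The step from -1 to 0 crosses between the two branches of [potential]. *)
  rewrite (_ : Negz 0 + 1 = 0) // potential0 /potential !big_ord_recl !big_ord0.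
  rewrite /= (_ : - 1 = Negz 0) //= oppr0; field; exact: a0.
rewrite (_ : Negz m.+1 + 1 = Negz m); last by lia.
rewrite /potential [in RHS]big_ord_recr [X in _ = _ / X * _]big_ord_recr /=.
rewrite !NegzE.
have h : \prod_(i < m.+1) a (- Posz i.+1) != 0 by apply/prodf_neq0 => *; apply: a0.
by field; rewrite h a0.
Qed.

Lemma potential_gt0 (R : realType) (a c : int -> R) (n : int) :
  (forall k, 0 < a k) -> (forall k, 0 < c k) -> 0 < potential a c n.
Proof.
by move=> a0 c0; case: n => m; apply: divr_gt0; apply: prodr_gt0.
Qed.

(** * Orthogonality *)

(** The difference vanishes at the nonzero points 1, 2, ..., as many as its size. The lemma serves
    identities obtained by inverting [T0_mx], which is possible only off 0. *)
Lemma poly_eq_off0 (R : realFieldType) (p q : {poly R}) :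
  (forall t, t != 0 -> p.[t] = q.[t]) -> p = q.
Proof.
move=> h; apply/eqP; rewrite -subr_eq0; apply/eqP.
pose s := [seq (k.+1%:R : R) | k <- iota 0 (size (p - q))].
apply: (@roots_geq_poly_eq0 _ _ s); last by rewrite size_map size_iota.
  apply/allP => t /mapP[k _ ->]; have k0 : (k.+1%:R : R) != 0 by rewrite pnatr_eq0.
  by rewrite rootE hornerD hornerN (h _ k0) subrr.
by rewrite map_inj_uniq ?iota_uniq // => k l /eqP; rewrite eqr_nat => /eqP [].
Qed.

(** Nonzero coefficients allow solving for [f n] as well as for [f (n - 1)], so the zero at [k]
    propagates both ways. *)
Lemma two_sided_recurrence0 (R : realFieldType) (u v f : int -> R) (k : int) :
  (forall n, u n != 0) -> (forall n, v n != 0) ->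
  (forall n, u n * f n + v n * f (n - 1) = 0) -> f k = 0 -> forall n, f n = 0.
Proof.
move=> u0 v0 rec fk.
have up (n : nat) : f (k + n%:Z) = 0.
  elim: n => [|n IH]; first by rewrite addr0.
  have := rec (k + n.+1%:Z); rewrite (_ : k + n.+1%:Z - 1 = k + n%:Z); last by lia.
  by rewrite IH mulr0 addr0 => /eqP; rewrite mulf_eq0 (negbTE (u0 _)) => /eqP.
have dn (n : nat) : f (k - n%:Z) = 0.
  elim: n => [|n IH]; first by rewrite subr0.
  have := rec (k - n%:Z); rewrite (_ : k - n%:Z - 1 = k - n.+1%:Z); last by lia.
  by rewrite IH mulr0 add0r => /eqP; rewrite mulf_eq0 (negbTE (v0 _)) => /eqP.
move=> n; have [h|h] := lerP k n.
  by rewrite (_ : n = k + `|n - k|%N%:Z) ?up //; lia.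
by rewrite (_ : n = k - `|n - k|%N%:Z) ?dn //; lia.
Qed.

(** * Positivity of the form on combinations of orthogonal vectors *)

Section WalkForm.
Context (R : realType) (W : mxmeasure R) (hW : mxm_finite W).
Context (Q : 'I_2 -> int -> {poly R}) (w : int -> R).
Hypothesis w0 : forall k, 0 < w k.
Hypothesis ortho : forall i j,
  mxm_form W (Q^~ i) (Q^~ j) = (i == j)%:R / w j.

Lemma mxm_form_suml (I : Type) (l : seq I) (k : I -> R) (f : I -> 'I_2 -> {poly R}) g :
  mxm_form W (fun al => \sum_(i <- l) k i *: f i al) g =
  \sum_(i <- l) k i * mxm_form W (f i) g.
Proof.
elim: l => [|i l IH].
  rewrite big_nil /mxm_form big1 // => al _; rewrite big1 // => be _.
  by rewrite big_nil mul0r poly_int0.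
rewrite big_cons -IH -mxm_formZl // -mxm_formDl //.
by congr mxm_form; apply/funext => al; rewrite big_cons.
Qed.

Lemma mxm_form_sumr (I : Type) (l : seq I) (k : I -> R) (f : I -> 'I_2 -> {poly R}) g :
  mxm_form W g (fun al => \sum_(i <- l) k i *: f i al) =
  \sum_(i <- l) k i * mxm_form W g (f i).
Proof.
elim: l => [|i l IH].
  rewrite big_nil /mxm_form big1 // => al _; rewrite big1 // => be _.
  by rewrite big_nil mulr0 poly_int0.
rewrite big_cons -IH -mxm_formZr // -mxm_formDr //.
by congr mxm_form; apply/funext => al; rewrite big_cons.
Qed.

Lemma mxm_form_span_ge0 (l : seq (R * int)) (f : 'I_2 -> {poly R}) :
  (forall al, f al = \sum_(k <- l) k.1 *: Q al k.2) -> 0 <= mxm_form W f f.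
Proof.
move=> /funext ->; rewrite mxm_form_suml.
under eq_bigr do rewrite mxm_form_sumr.
(* An index may occur several times in [l], so [d j] collects the total coefficient at [j];
   orthogonality then turns the form into the sum of [d j ^+ 2 / w j]. *)
pose J := undup [seq k.2 | k <- l].
pose d j := \sum_(k <- l) k.1 * (k.2 == j)%:R.
rewrite (_ : \sum_(i <- l) _ = \sum_(j <- J) d j * d j / w j); last first.
  transitivity (\sum_(k <- l) \sum_(k' <- l) \sum_(j <- J)
      (k.1 * (k.2 == j)%:R) * (k'.1 * (k'.2 == j)%:R) / w j).
    rewrite big_seq [RHS]big_seq; apply: eq_bigr => k kl.
    rewrite big_distrr; apply: eq_bigr => k' _ /=; rewrite ortho.
    have kJ : k.2 \in J by rewrite mem_undup map_f.
    rewrite (bigD1_seq k.2) ?undup_uniq //= big1 => [|j /negbTE jk]; last first.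
      by rewrite [k.2 == j]eq_sym jk !mulr0 !mul0r.
    rewrite eqxx [k'.2 == _]eq_sym; case: eqP => [->|_]; last first.
      by rewrite !(mulr0, mul0r, addr0).
    by rewrite addr0 !mulr1 mul1r mulrA.
  under eq_bigr do rewrite exchange_big.
  rewrite exchange_big; apply: eq_bigr => j _ /=.
  rewrite /d mulr_suml mulr_suml; apply: eq_bigr => k _.
  by rewrite mulr_sumr mulr_suml.
by apply: sumr_ge0 => j _; rewrite divr_ge0 ?(ltW (w0 _)) // -expr2 sqr_ge0.
Qed.

End WalkForm.

Lemma walk_span (R : realType) (a b c : int -> R) (Q : 'I_2 -> int -> {poly R})
    (al : 'I_2) (p : {poly R}) :
  walk_polynomials a b c Q ->
  exists l : seq (R * int), forall be,
    (be == al)%:R * p = \sum_(k <- l) k.1 *: Q be k.2.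
Proof.
move=> [[Q00 Q10] [Q01 Q11] rec].
elim/poly_ind: p => [|p k [l hl]].
  by exists [::] => be; rewrite mulr0 big_nil.
(* The constant [k] sits at index 0 or -1, where the walk polynomials form unit vectors; the product
   of the earlier combination with ['X] is expanded by the three-term recurrence. *)
exists ((k, if al == 0 then 0 else -1) ::
  flatten [seq [:: (e.1 * a e.2, e.2 + 1); (e.1 * b e.2, e.2);
                   (e.1 * c e.2, e.2 - 1)] | e <- l]) => be.
rewrite big_cons mulrDr mulrA hl mulr_suml addrC; congr (_ + _).
  by rewrite -mul_polyC [RHS]mulrC; congr (_ * _);
    have [->|->] := ord2P al; have [->|->] := ord2P be.
rewrite big_flatten big_map; apply: eq_bigr => e _.
rewrite !big_cons big_nil /= addr0 -!scalerA -scalerAl mulrC rec.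
by rewrite !scalerDr addrA.
Qed.

(** * The Darboux transformation of the polynomials *)

Section Darboux.
Context (R : realType) (a b c : int -> R) (Q : 'I_2 -> int -> {poly R}).
Context (r s y x : int -> R).
Hypothesis hQ : walk_polynomials a b c Q.
Hypothesis hLU : stochastic_LU (tridiag c b a) r s y x.

Let T := darboux_T y x Q.

(** In matrix form, [T = P_U Q] and [x Q = P Q = P_L (P_U Q) = P_L T]. *)
Lemma walk_lower al n : 'X * Q al n = s n *: T al n + r n *: T al (n - 1).
Proof.
have [_ _ ->] := hQ; rewrite /T /darboux_T subrK.
rewrite (LU_a hLU) (LU_b hLU) (LU_c hLU) !scalerDr !scalerDl !scalerA.
rewrite -!mul_polyC !polyCM; ring.
Qed.

(** In matrix form, [x T = P_U (x Q) = (P_U P_L) T]. *)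
Lemma T_rec al n : 'X * T al n = dar_a r s y x n *: T al (n + 1)
  + dar_b r s y x n *: T al n + dar_c r s y x n *: T al (n - 1).
Proof.
rewrite {1}/T /darboux_T mulrDr -!scalerAr !walk_lower addrK.
rewrite dar_aE dar_bE dar_cE !scalerDr !scalerDl !scalerA.
rewrite -!mul_polyC !polyCM; ring.
Qed.

Lemma T_m1 : T 0 (-1) = (x (-1))%:P /\ T 1 (-1) = (y (-1))%:P.
Proof.
have [[Q00 Q10] [Q01 Q11] _] := hQ.
rewrite /T /darboux_T (_ : -1 + 1 = 0) // Q00 Q10 Q01 Q11.
by rewrite !scaler0 add0r addr0 !alg_polyC.
Qed.

Lemma poly_block_T0 t : poly_block T 0 t = T0_mx r s y x t.
Proof.
have [[Q00 Q10] [Q01 Q11] _] := hQ; have [Tx Ty] := T_m1.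
have [_ s0 _ _] := LU_neq0 hLU 0.
apply/matrixP => i j; rewrite /poly_block /T0_mx /mx2 !mxE.
(* The row [T_0] is obtained by solving [walk_lower] at [n = 0], which involves only [Q_0] and the
   constant row [T_{-1}]. *)
have e0 al : (T al 0).[t] = (t * (Q al 0).[t] - r 0 * (T al (-1)).[t]) / s 0.
  have := congr1 (horner^~ t) (walk_lower al 0).
  rewrite !(hornerD, hornerM, hornerX, hornerZ) sub0r => ->.
  by field.
have [->|->] := ord2P i; have [->|->] := ord2P j => /=.
- by rewrite e0 Q00 Tx !hornerC mulr1.
- by rewrite e0 Q10 Ty !hornerC mulr0 sub0r mulNr.
- by rewrite oppr0 sub0r Tx hornerC.
- by rewrite oppr0 sub0r Ty hornerC.
Qed.

(** The terms with [r 0] cancel in the determinant, leaving [t * y (-1) / s 0]. *)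
Lemma T0_mx_unit t : t != 0 -> T0_mx r s y x t \in unitmx.
Proof.
move=> t0; have [_ s0 _ _] := LU_neq0 hLU 0; have [_ _ y0 _] := LU_neq0 hLU (-1).
rewrite unitmxE unitfE (expand_det_row _ 0) !big_ord_recl big_ord0 /cofactor.
rewrite !det_mx11 /T0_mx /mx2 !mxE /= /bump /= expr0 expr1 addr0.
rewrite (_ : _ + _ = t * y (-1) / s 0); last by field.
by rewrite !mulf_neq0 ?invr_eq0.
Qed.

Definition T0_poly (i al : 'I_2) : {poly R} := T al (if i == 0 then 0 else -1).

Lemma T0_polyE t i al : T0_mx r s y x t i al = (T0_poly i al).[t].
Proof.
rewrite -poly_block_T0 /poly_block mxE /T0_poly.
by have [->|->] := ord2P i; rewrite /= ?oppr0 ?sub0r.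
Qed.

Lemma T0_poly_inj (D : 'I_2 -> {poly R}) :
  (forall al, \sum_(g < 2) D g * T0_poly g al = 0) -> forall g, D g = 0.
Proof.
move=> h g; apply: poly_eq_off0 => t t0; rewrite horner0.
have e : \row_g (D g).[t] *m T0_mx r s y x t = 0.
  apply/rowP => al; rewrite !mxE.
  have := congr1 (horner^~ t) (h al); rewrite horner_sum horner0 => h0.
  rewrite -[RHS]h0.
  by apply: eq_bigr => i _; rewrite hornerM T0_polyE mxE.
have := congr1 (mulmx^~ (invmx (T0_mx r s y x t))) e.
by rewrite mulmxK ?T0_mx_unit // mul0mx => /rowP /(_ g); rewrite !mxE.
Qed.

Context (Qhat : 'I_2 -> int -> {poly R}).
Hypothesis hQhat : forall (n : nat) (t : R), poly_block T 0 t \in unitmx ->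
  poly_block Qhat n t = poly_block T n t *m invmx (poly_block T 0 t).

(** Multiplying the defining relation by [T0_mx] clears the inverse; the result, valid for [t != 0],
    extends to an identity of polynomials. The rows of the blocks run through all integer indices,
    [Negz m] being the lower row of block [m]. *)
Lemma Qhat_T0 al n : \sum_(g < 2) Qhat g n * T0_poly g al = T al n.
Proof.
apply: poly_eq_off0 => t t0; have ut := T0_mx_unit t0.
have e (m : nat) : poly_block Qhat m t *m T0_mx r s y x t = poly_block T m t.
  by rewrite hQhat poly_block_T0 // mulmxKV.
rewrite horner_sum; case: n => m.
  have := congr1 (fun A : 'M[R]_2 => A 0 al) (e m); rewrite !mxE /= => <-.
  by apply: eq_bigr => i _; rewrite hornerM T0_polyE mxE.
have := congr1 (fun A : 'M[R]_2 => A 1 al) (e m); rewrite !mxE /=.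
rewrite (_ : - m%:Z - 1 = Negz m) => [<-|]; last by lia.
apply: eq_bigr => i _; rewrite hornerM T0_polyE mxE /=.
by rewrite (_ : - m%:Z - 1 = Negz m) //; lia.
Qed.

(** Right multiplication by [T0_poly] is injective and sends [Qhat] to [T], so initial values and
    recurrence are checked on [T]. *)
Lemma Qhat_walk :
  walk_polynomials (dar_a r s y x) (dar_b r s y x) (dar_c r s y x) Qhat.
Proof.
have init (i g : 'I_2) : Qhat g (if i == 0 then 0 else -1) = (g == i)%:R.
  apply/eqP; rewrite -subr_eq0; apply/eqP; move: g.
  apply: T0_poly_inj => al.
  under eq_bigr do rewrite mulrBl.
  rewrite sumrB Qhat_T0 (bigD1 i) //= big1 => [|j /negbTE ->]; last by rewrite mul0r.
  by rewrite eqxx mul1r addr0 subrr.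
split; [by rewrite !(init 0)|by rewrite !(init 1)|].
move=> g n; apply/eqP; rewrite -subr_eq0; apply/eqP; move: g.
apply: T0_poly_inj => al.
under eq_bigr do rewrite mulrBl !mulrDl -!scalerAl -mulrA.
by rewrite sumrB !big_split /= -!scaler_sumr -mulr_sumr !Qhat_T0 T_rec subrr.
Qed.

End Darboux.

(** * Orthogonality of the [T_n] for [Psi_T] *)

Section Orthogonality.
Context (R : realType) (a b c : int -> R) (Q : 'I_2 -> int -> {poly R}).
Context (Psi : R -> 'M[R]_2) (r s y x : int -> R).
Hypothesis hP : random_walk a b c.
Hypothesis hQ : walk_polynomials a b c Q.
Hypothesis hLU : stochastic_LU (tridiag c b a) r s y x.
Hypothesis hPsi : spectral_matrix a c Q (MxMeasure Psi 0).
Hypothesis hM : moment_m1_defined Psi.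

Let W := MxMeasure Psi 0.
Let PsiT := Psi_T r s y x Psi.
Let T := darboux_T y x Q.
Let sigma := s 0 / y 0.
(** This scalar of the atom is the inverse of the Darboux potential at -1. *)
Let kappa := dar_a r s y x (-1) / dar_c r s y x 0.
Let ahat := dar_a r s y x.
Let chat := dar_c r s y x.

Lemma density_Psi_T t al be :
  density PsiT t al be = sigma * (Psi t al be / t).
Proof. by rewrite /= !mxE [t^-1 * _]mulrC. Qed.

Lemma mxm_finite_Psi_T : mxm_finite PsiT.
Proof.
move=> al be.
rewrite (_ : (fun t => _) = (fun t => (sigma%:P.[t] * (Psi t al be / t))%:E)).
  exact: integrable_horner (hM al be).
by apply/funext => t; rewrite density_Psi_T hornerC.
Qed.

Lemma poly_int_Psi_T_X al be (p : {poly R}) :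
  poly_int PsiT al be ('X * p) = sigma * poly_int W al be p.
Proof.
have [hW _ _ _] := hPsi.
rewrite /poly_int /mxm_int hornerM hornerX !mul0r !addr0 !mxE mulr0 addr0.
rewrite -RintegralZl //; last exact: integrable_horner (hW al be).
rewrite /Rintegral; congr fine.
apply: ae_eq_integral => //.
- apply: (measurable_int (@lebesgue_measure R)).
  exact: integrable_horner (mxm_finite_Psi_T al be).
- apply: (measurable_int (@lebesgue_measure R)).
  have := integrable_horner (sigma *: p) (hW al be).
  by congr (is_true (_.-integrable _ _)); apply/funext => t; rewrite hornerZ mulrA.
(* The factor [t] cancels [t^-1] except at 0, where the inverse is 0 by convention; a single point
   is a null set. *)
- exists [set 0]; split => //; first exact: lebesgue_measure_set1.
  move=> t /= /not_implyP[_ ht]; apply: contrapT => /eqP t0; apply: ht.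
  by rewrite -/PsiT density_Psi_T hornerM hornerX; congr EFin; field.
Qed.

(** The density contributes [sigma] times the moment [M_{-1}], which the atom subtracts again, so
    only its diagonal matrix is left. *)
Lemma poly_int_Psi_T_C al be (k : R) : poly_int PsiT al be k%:P =
  k * (kappa * mx2 (x (-1))^-1 0 0 (y (-1))^-1 al be).
Proof.
rewrite /poly_int /mxm_int hornerC.
under eq_Rintegral do rewrite hornerC density_Psi_T mulrA.
rewrite RintegralZl //; last exact: hM.
by rewrite /PsiT /Psi_T /= !mxE -/sigma -/kappa; ring.
Qed.

Lemma mxm_form_Psi_T_Xl f g :
  mxm_form PsiT (fun al => 'X * f al) g = sigma * mxm_form W f g.
Proof.
rewrite /mxm_form big_distrr; apply: eq_bigr => al _ /=.
rewrite big_distrr; apply: eq_bigr => be _ /=.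
by rewrite -mulrA poly_int_Psi_T_X.
Qed.

Lemma mxm_form_Psi_T_Xr f g :
  mxm_form PsiT f (fun al => 'X * g al) = sigma * mxm_form W f g.
Proof.
rewrite /mxm_form big_distrr; apply: eq_bigr => al _ /=.
rewrite big_distrr; apply: eq_bigr => be _ /=.
by rewrite mulrCA poly_int_Psi_T_X.
Qed.

Lemma Q_ortho i j :
  mxm_form W (Q^~ i) (Q^~ j) = (i == j)%:R / potential a c j.
Proof.
have [_ _ _ <-] := hPsi.
by apply: eq_bigr => al _; apply: eq_bigr => be _; rewrite poly_intE.
Qed.

Lemma walk_gt0 n : 0 < a n /\ 0 < c n.
Proof. by have [_ _ /andP[-> _] /andP[-> _]] := hP n. Qed.

Lemma dar_gt0 n : 0 < ahat n /\ 0 < chat n.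
Proof.
rewrite /ahat /chat dar_aE dar_cE.
have [[_ _ /andP[r0 _] /andP[s0 _]] [/andP[y0 _] /andP[x0 _]]] := hLU.1 n.
have [[_ _ _ /andP[s1 _]] _] := hLU.1 (n + 1).
by rewrite !mulr_gt0.
Qed.

Let p n := potential a c n.
Let ph n := potential ahat chat n.

Lemma potential_neq0 n : p n != 0.
Proof. by rewrite gt_eqF // potential_gt0 // => k; case: (walk_gt0 k). Qed.

Lemma potential_dar_gt0 n : 0 < ph n.
Proof. by rewrite potential_gt0 // => k; case: (dar_gt0 k). Qed.

Lemma potential_dar_neq0 n : ph n != 0.
Proof. by rewrite gt_eqF // potential_dar_gt0. Qed.

Lemma potential_rec n : p n * (r n * y (n - 1)) = p (n - 1) * (s (n - 1) * x (n - 1)).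
Proof.
have := @potentialS _ a c (n - 1).
rewrite subrK (LU_c hLU) (LU_a hLU); apply => k; rewrite gt_eqF //;
  by case: (walk_gt0 k).
Qed.

Lemma potential_dar_rec n : ph n * (y n * r n) = ph (n - 1) * (x (n - 1) * s n).
Proof.
have := @potentialS _ ahat chat (n - 1).
rewrite subrK [chat n]dar_cE [ahat (n - 1)]dar_aE subrK; apply => k; rewrite gt_eqF //;
  by case: (dar_gt0 k).
Qed.

(** With [potential_dar_pred], this is the adjointness [diag(p) P_L = sigma (diag(ph) P_U)^T] read
    entrywise. Both sides obey the same first-order recurrence, by detailed balance for the two
    walks, and equal [s 0] at index 0. *)
Lemma potential_dar n : s n * p n = sigma * y n * ph n.
Proof.
apply/eqP; rewrite -subr_eq0; apply/eqP.
apply: (@two_sided_recurrence0 _ (fun n => r n * y (n - 1))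
  (fun n => - (s n * x (n - 1))) (fun n => s n * p n - sigma * y n * ph n) 0).
- move=> k; have [rk _ _ _] := LU_neq0 hLU k.
  by have [_ _ yk _] := LU_neq0 hLU (k - 1); rewrite mulf_neq0.
- move=> k; have [_ sk _ _] := LU_neq0 hLU k.
  by have [_ _ _ xk] := LU_neq0 hLU (k - 1); rewrite oppr_eq0 mulf_neq0.
- move=> k; have hp := potential_rec k; have hh := potential_dar_rec k; rewrite /=.
  rewrite [LHS](_ : _ = s k * (p k * (r k * y (k - 1)))
     - sigma * y (k - 1) * (ph k * (y k * r k))
     - s k * x (k - 1) * s (k - 1) * p (k - 1)
     + s k * x (k - 1) * sigma * y (k - 1) * ph (k - 1)).
    by rewrite hp hh; ring.
  by ring.
- rewrite /p /ph !potential0 /sigma; have [_ _ y0 _] := LU_neq0 hLU 0.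
  by field.
Qed.

Lemma potential_dar_pred n : r n * p n = sigma * x (n - 1) * ph (n - 1).
Proof.
have [_ _ y0 _] := LU_neq0 hLU (n - 1).
apply: (mulIf y0).
have -> : r n * p n * y (n - 1) = p n * (r n * y (n - 1)) by ring.
have -> : p n * (r n * y (n - 1)) = s (n - 1) * p (n - 1) * x (n - 1).
  by rewrite potential_rec; ring.
by rewrite potential_dar; ring.
Qed.

Let G n m := mxm_form PsiT (T^~ n) (T^~ m).

Lemma mxm_form_Tr (f : 'I_2 -> {poly R}) V m : mxm_finite V ->
  mxm_form V f (T^~ m) =
  y m * mxm_form V f (Q^~ m) + x m * mxm_form V f (Q^~ (m + 1)).
Proof.
by move=> hV; rewrite -!mxm_formZr // -mxm_formDr.
Qed.

Lemma mxm_form_Tl (f : 'I_2 -> {poly R}) V m : mxm_finite V ->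
  mxm_form V (T^~ m) f =
  y m * mxm_form V (Q^~ m) f + x m * mxm_form V (Q^~ (m + 1)) f.
Proof.
by move=> hV; rewrite -!mxm_formZl // -mxm_formDl.
Qed.

(** The left side pairs ['X * Q_n] with [T_m]; the factor ['X] trades [Psi_T] for [sigma] times
    [Psi], where the orthogonality of the [Q_n] applies. *)
Lemma Psi_T_recl n m : s n * G n m + r n * G (n - 1) m =
  sigma * (y m * ((n == m)%:R / p m) + x m * ((n == m + 1)%:R / p (m + 1))).
Proof.
have [hW _ _ _] := hPsi; have hT := mxm_finite_Psi_T.
rewrite -!Q_ortho -mxm_form_Tr // -mxm_form_Psi_T_Xl /G.
rewrite -!mxm_formZl // -mxm_formDl //.
by congr mxm_form; apply/funext => al; rewrite (walk_lower hQ hLU).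
Qed.

Lemma Psi_T_recr n m : s m * G n m + r m * G n (m - 1) =
  sigma * (y n * ((n == m)%:R / p m) + x n * ((n + 1 == m)%:R / p m)).
Proof.
have [hW _ _ _] := hPsi; have hT := mxm_finite_Psi_T.
rewrite -!Q_ortho -mxm_form_Tl // -mxm_form_Psi_T_Xr /G.
rewrite -!mxm_formZr // -mxm_formDr //.
by congr mxm_form; apply/funext => al; rewrite (walk_lower hQ hLU).
Qed.

(** Pairing the constant row [(x (-1), y (-1))] with itself gives
    [kappa * (x (-1) + y (-1)) = kappa], and detailed balance between -1 and 0 identifies
    [kappa]. *)
Lemma Psi_T_base : G (-1) (-1) = (ph (-1))^-1.
Proof.
have [_ _ y0 x0] := LU_neq0 hLU (-1).
have [Tx Ty] := T_m1 y x hQ.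
have -> : (ph (-1))^-1 = kappa.
  have := @potentialS _ ahat chat (-1).
  rewrite (_ : -1 + 1 = 0) // potential0 mul1r => h.
  have c0 : chat 0 != 0 by rewrite gt_eqF //; case: (dar_gt0 0).
  have a0 : ahat (-1) != 0 by rewrite gt_eqF //; case: (dar_gt0 (-1)).
  have p0 := potential_dar_neq0 (-1).
  rewrite /kappa -/ahat -/chat h.
  - by rewrite -/(ph (-1)); field; rewrite a0 p0.
  - by move=> k; rewrite gt_eqF //; case: (dar_gt0 k).
  - by move=> k; rewrite gt_eqF //; case: (dar_gt0 k).
have xy : y (-1) + x (-1) = 1 by have [[]] := hLU.1 (-1).
rewrite /G /mxm_form !big_ord_recl !big_ord0 !addr0.
rewrite (_ : lift ord0 ord0 = 1); last by apply/val_inj.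
rewrite (_ : ord0 = 0 :> 'I_2); last by apply/val_inj.
rewrite /T /= Tx Ty -!polyCM !poly_int_Psi_T_C /mx2 !mxE /=.
by rewrite -[RHS]mulr1 -xy; field; rewrite x0 y0.
Qed.

Lemma Psi_T_ortho n m : mxm_form PsiT (T^~ n) (T^~ m) = (n == m)%:R / ph m.
Proof.
have r0 k : r k != 0 by have [] := LU_neq0 hLU k.
have s0 k : s k != 0 by have [] := LU_neq0 hLU k.
pose e i j : R := (i == j)%:R / ph j.
(* The claimed values satisfy the recurrence of the pairings: the two potential identities settle
   the cases [i = j] and [i = j + 1]. *)
have e_recl i j : s i * e i j + r i * e (i - 1) j =
    sigma * (y j * ((i == j)%:R / p j) + x j * ((i == j + 1)%:R / p (j + 1))).
  have h1 := potential_dar j; have h2 := potential_dar_pred (j + 1).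
  rewrite addrK in h2.
  have pj := potential_neq0 j; have pj1 := potential_neq0 (j + 1).
  have phj := potential_dar_neq0 j.
  have d1 : s j / ph j = sigma * y j / p j.
    by apply/eqP; rewrite eqr_div // h1.
  have d2 : r (j + 1) / ph j = sigma * x j / p (j + 1).
    by apply/eqP; rewrite eqr_div // h2.
  rewrite /e (_ : (i - 1 == j) = (i == j + 1)); last by rewrite subr_eq.
  case: eqP => [->|_]; case: eqP => [ij|_]; rewrite ?(mul0r, mulr0, addr0, add0r) //.
  - by exfalso; lia.
  - by rewrite !mul1r d1 mulrA.
  - by rewrite ij !mul1r d2 mulrA.
have e_sym i j : e i j = e j i.
  by rewrite /e eq_sym; case: eqP => [->|] //; rewrite !mul0r.
pose D i j := G i j - e i j.
have Dl i j : s i * D i j + r i * D (i - 1) j = 0.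
  by rewrite /D !mulrBr addrACA -opprD Psi_T_recl e_recl subrr.
have Dr i j : s j * D i j + r j * D i (j - 1) = 0.
  rewrite /D !mulrBr addrACA -opprD Psi_T_recr ![e i _]e_sym e_recl.
  rewrite [j == i]eq_sym [j == i + 1]eq_sym.
  apply/eqP; rewrite subr_eq0; apply/eqP.
  (* The two sides differ only in which of two equal indices [p] is taken at. *)
  by do 2![congr (_ * _) || congr (_ + _)]; case: eqP => [->|]; rewrite ?mul0r.
have D0 : D (-1) (-1) = 0 by rewrite /D /e Psi_T_base eqxx mul1r subrr.
(* The zero at (-1, -1) spreads first along row -1, then from that row along every column. *)
have D1 j : D (-1) j = 0.
  exact: (two_sided_recurrence0 s0 r0 (Dr (-1)) D0).
apply/eqP; rewrite -subr_eq0; apply/eqP.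
exact: (two_sided_recurrence0 s0 r0 (fun i => Dl i m) (D1 m)).
Qed.

End Orthogonality.

(** * Transfer from [Psi_T] to the spectral matrix of the Darboux walk *)

Theorem theorem3p9 (R : realType) (a b c : int -> R)
    (Q : 'I_2 -> int -> {poly R}) (Psi : R -> 'M[R]_2)
    (r s y x : int -> R) (Qhat : 'I_2 -> int -> {poly R})
    (hP : random_walk a b c)
    (hQ : walk_polynomials a b c Q)
    (hPsi : spectral_matrix a c Q (MxMeasure Psi 0))
    (hLU : stochastic_LU (tridiag c b a) r s y x)
    (hM : moment_m1_defined Psi)
    (hQhat : forall (n : nat) (t : R),
       poly_block (darboux_T y x Q) 0 t \in unitmx ->
       poly_block Qhat n t =
         poly_block (darboux_T y x Q) n t
           *m invmx (poly_block (darboux_T y x Q) 0 t)) :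
  let ahat := dar_a r s y x in
  let bhat := dar_b r s y x in
  let chat := dar_c r s y x in
  let Psihat := Psi_hat r s y x Psi in
  [/\ forall t : R, poly_block (darboux_T y x Q) 0 t = T0_mx r s y x t,
      walk_polynomials ahat bhat chat Qhat,
      spectral_matrix ahat chat Qhat Psihat &
      forall n m : nat,
        mxm_mass (mxm_sandwich (poly_block Qhat n) Psihat (poly_block Qhat m))
                 `[-1, 1]
        = (n == m)%:R *:
            mx2 (potential ahat chat n%:Z)^-1 0
                0 (potential ahat chat (- n%:Z - 1))^-1].
Proof.
move=> ahat bhat chat Psihat.
have hT0 := poly_block_T0 hQ hLU.
have hwalk := Qhat_walk hQ hLU hQhat.
have fT := mxm_finite_Psi_T r s y x hM.
have fhat : mxm_finite Psihat.
  exact: (mxm_finite_sandwich fT (T0_polyE hQ hLU) (T0_polyE hQ hLU)).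
have ortho i j : mxm_form Psihat (Qhat^~ i) (Qhat^~ j)
    = (i == j)%:R / potential ahat chat j.
  rewrite (mxm_form_sandwich fT (T0_polyE hQ hLU) (T0_polyE hQ hLU)).
  rewrite -(Psi_T_ortho hP hQ hLU hPsi hM).
  by congr mxm_form; apply/funext => al; rewrite (Qhat_T0 hQ hLU hQhat).
have ph0 k : 0 < potential ahat chat k by exact: potential_dar_gt0 hLU k.
split => //.
  split => //.
  - move=> E mE; apply: mxm_symmetric_mass => //; apply: mxm_symmetric_sandwich.
    have [fPsi sPsi _ _] := hPsi.
    (* The symmetry of [Psi] almost everywhere passes to [Psi / t] and to its integral [moment_m1],
       hence to [Psi_T]. *)
    have [_ [N [mN N0 sN]]] := mass_sym_density fPsi erefl sPsi.
    split.
      move=> al be; rewrite !mxE; congr (_ * _ - _ * _).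
        by have [->|->] := ord2P al; have [->|->] := ord2P be.
      rewrite /Rintegral; congr fine; apply: ae_eq_integral => //.
      - exact: measurable_int (hM al be).
      - exact: measurable_int (hM be al).
      - exists N; split => // t /= ht; apply: sN => /= h; apply: ht.
        by rewrite in_itv /= => tD; rewrite (h tD).
    exists N; split => // t /= ht; apply: sN => /= h; apply: ht => tD al be.
    by rewrite !mxE (h tD).
  - move=> al E mE; rewrite /mxm_mass mxE.
    apply: square_positive_mass_ge0 (fhat al al) _ E mE => q.
    (* On the vector with [q] in coordinate [al] and 0 elsewhere, the form is the integral of
       [q ^+ 2] against the diagonal entry. *)
    have [l hl] := walk_span al q hwalk.
    have := mxm_form_span_ge0 fhat ph0 ortho hl.
    rewrite /mxm_form (bigD1 al) //= [X in _ + X]big1; last first.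
      move=> i /negbTE ial; rewrite big1 // => j _.
      by rewrite ial !mul0r poly_int0.
    rewrite addr0 (bigD1 al) //= [X in _ + X]big1; last first.
      by move=> i /negbTE ial; rewrite ial mul0r mulr0 poly_int0.
    rewrite addr0 eqxx !mul1r -expr2 /poly_int /mxm_int horner_exp.
    by under eq_Rintegral do rewrite horner_exp.
  - move=> i j; rewrite -ortho; apply: eq_bigr => al _; apply: eq_bigr => be _.
    by rewrite poly_intE.
move=> n m; apply/matrixP => i j; rewrite mxm_mass_itv.
pose idx (k : nat) (i : 'I_2) : int := if i == 0 then k%:Z else - k%:Z - 1.
have hF k t (i' al : 'I_2) : poly_block Qhat k t i' al = (Qhat al (idx k i')).[t].
  by rewrite mxE.
(* Each entry of the total mass is the form evaluated on a row of either block. *)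
rewrite (poly_int_sandwich fhat (hF n) (hF m)).
under eq_bigr do under eq_bigr do rewrite mul1r.
rewrite -/(mxm_form Psihat (Qhat^~ (idx n i)) (Qhat^~ (idx m j))) ortho !mxE /idx.
have eN : (- n%:Z - 1 == - m%:Z - 1) = (n == m).
  by apply/eqP/eqP => [?|->]; lia.
have [->|->] := ord2P i; have [->|->] := ord2P j => /=.
- by rewrite eqz_nat; case: eqP => [->|_]; rewrite ?mul0r.
(* Upper rows have indices at least 0 and lower rows at most -1, so mixed entries vanish. *)
- by rewrite mulr0 (_ : (_ == _) = false) ?mul0r //; apply/eqP; lia.
- by rewrite mulr0 (_ : (_ == _) = false) ?mul0r //; apply/eqP; lia.
- by rewrite eN; case: eqP => [->|_]; rewrite ?mul0r.
Qed.
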